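(* Let $A$ be a finite set with $N\ge2$ options, and let $v$ be the collective Llull matrix of a vote whose individual votes are rankings (possibly truncated and with ties). Let $x\in A$. Then the rank-like rate of $x$ satisfies $r_x=1$ if and only if all voters have put $x$ into first place (that is, every voter lists $x$ and ranks $x$ strictly above every other option, unlisted options counting as ranked below listed ones).
   Context: Let $A$ be a finite set with $N\ge2$ elements and $\Pi$ the set of ordered pairs $xy$ with $x,y\in A$, $x\ne y$. A relation on $A$ is a subset of $\Pi$. A Llull matrix on $A$ is a family $v=(v_{xy})_{xy\in\Pi}$ with $v_{xy}\in[0,1]$ and $v_{xy}+v_{yx}\le1$. Turnovers: $t_{xy}=v_{xy}+v_{yx}$. Ranking votes: each vote $k$ consists of a list $L\subseteq A$ ranked by a complete ranking (ties allowed), and its matrix is $v^k_{xy}=1$ if $x,y\in L$ with $x$ ranked strictly above $y$, or $x\in L$, $y\notin L$; $v^k_{xy}=1/2$ if $x,y\in L$ are tied; $v^k_{xy}=0$ otherwise. The collective matrix is the weighted average $v=\sum_k\alpha_kv^k$ over the finitely many voters, with weights $\alpha_k>0$, $\sum_k\alpha_k=1$. Indirect scores: $v^*_{xy}=\max\min_{0\le i<n}v_{x_ix_{i+1}}$, the max being over all paths $x_0x_1\dots x_n$ ($n\ge1$, consecutive elements distinct) with $x_0=x$, $x_n=y$. Put $m^\nu_{xy}=v^*_{xy}-v^*_{yx}$, $\nu=\{xy\in\Pi: m^\nu_{xy}>0\}$, $\hat\nu=\{xy\in\Pi: m^\nu_{xy}\ge0\}$. An admissible order is a (strict) total order $\xi\subseteq\Pi$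 with $\nu\subseteq\xi\subseteq\hat\nu$; one always exists. Write $x\succ y$ for $xy\in\xi$, $x\succeq y$ for $x\succ y$ or $x=y$, and $x'$ for the immediate successor of $x$ in $\xi$ (for $x$ not last). Given an admissible order $\xi$, the projected scores are obtained as follows. (i) For $x\succ y$: $m^\sigma_{xy}=\min\{m^\nu_{pq}: p\succeq x,\ y\succeq q\}$. (ii) $(t^\sigma_{xy})_{xy\in\Pi}$ is the unique minimizer of $\sum_{xy\in\Pi}(\tau_{xy}-t_{xy})^2$ among all real families $(\tau_{xy})_{xy\in\Pi}$ such that $\tau_{xy}=\tau_{yx}$ for all $xy$; $m^\sigma_{xx'}\le\tau_{xx'}\le1$ for all non-last $x$; $0\le\tau_{xy}-\tau_{xy'}\le m^\sigma_{yy'}$ for all non-last $y$ and all $x\notin\{y,y'\}$. (iii) $\gamma_{xx'}=[(t^\sigma_{xx'}-m^\sigma_{xx'})/2,\ (t^\sigma_{xx'}+m^\sigma_{xx'})/2]$, and for $x\succ y$, $\gamma_{xy}=\bigcup\{\gamma_{pp'}: x\succeq p\succ y\}$, which is a closed interval. (iv) For $x\succ y$: $v^\pi_{xy}=\max\gamma_{xy}$, $v^\pi_{yx}=\min\gamma_{xy}$. The projected scores do not depend on the choice of $\xi$. Rank-like rates: $r_x=N-\sum_{y\ne x}v^\pi_{xy}$. *)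

(* Defs.v *)
From mathcomp Require Import all_boot all_order all_algebra.
From mathcomp Require Import all_classical all_reals.

Set Implicit Arguments.
Unset Strict Implicit.
Unset Printing Implicit Defensive.

Import Order.TTheory GRing.Theory Num.Theory.
Local Open Scope classical_set_scope.
Local Open Scope ring_scope.

(* Families indexed by ordered pairs of distinct options are functions
   A -> A -> R; their diagonal values are never used. *)

Section Votes.
Variables (R : realType) (A : finType).

(* [weakly_above x y] means that x is ranked above y or tied with it; it is
   meaningful on listed options only, where it is a total preorder. *)
Record ballot := Ballot {
  listed : {set A};
  weakly_above : rel A;
  weakly_above_total : {in listed &, total weakly_above};
  weakly_above_trans : {in listed & &, transitive weakly_above}
}.

Definition strictly_above (b : ballot) : rel A :=
  fun x y => weakly_above b x y && ~~ weakly_above b y x.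

Definition tied (b : ballot) : rel A :=
  fun x y => weakly_above b x y && weakly_above b y x.

Definition ballot_matrix (b : ballot) (x y : A) : R :=
  if x \in listed b then
    if y \in listed b then
      if strictly_above b x y then 1 else if tied b x y then 1 / 2 else 0
    else 1
  else 0.

Definition collective (K : finType) (alpha : K -> R) (b : K -> ballot)
  (x y : A) : R := \sum_(k : K) alpha k * ballot_matrix (b k) x y.

Definition puts_first (b : ballot) (x : A) : Prop :=
  x \in listed b /\
  forall y, y != x -> y \in listed b -> strictly_above b x y.

End Votes.

Section ProjectedScores.
Variables (R : realType) (A : finType) (v : A -> A -> R).

Definition turnover (x y : A) : R := v x y + v y x.

(* The path x_0 x_1 ... x_n is coded by x = x_0 and p = [:: x_1; ...; x_n]. *)
Definition is_path (x y : A) (p : seq A) : Prop :=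
  [/\ p != [::], path (fun a b => a != b) x p & last x p = y].

(* The initial value of the minimum is the score of the first link. *)
Definition path_score (x : A) (p : seq A) : R :=
  \big[Num.min/v x (head x p)]_(e <- pairmap pair x p) v e.1 e.2.

(* The supremum is a maximum: path scores belong to the finite range of v. *)
Definition indirect (x y : A) : R :=
  sup [set path_score x p | p in [set p | is_path x y p]].

Definition margin_nu (x y : A) : R := indirect x y - indirect y x.

Definition admissible (xi : rel A) : Prop :=
  [/\ irreflexive xi,
      transitive xi,
      forall x y, x != y -> xi x y || xi y x,
      forall x y, x != y -> 0 < margin_nu x y -> xi x y
    & forall x y, xi x y -> 0 <= margin_nu x y].

Variable xi : rel A.

Definition weak (x y : A) : bool := (x == y) || xi x y.

Definition is_succ (x y : A) : bool :=
  xi x y && [forall z, ~~ (xi x z && xi z y)].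

(* For xi x y; the pair (x, y) itself belongs to the range of the minimum, so
   the initial value is harmless. *)
Definition margin_sigma (x y : A) : R :=
  \big[Num.min/margin_nu x y]_(pq : A * A | weak pq.1 x && weak y pq.2)
    margin_nu pq.1 pq.2.

Definition feasible (tau : A -> A -> R) : Prop :=
  [/\ forall x y, x != y -> tau x y = tau y x,
      forall x x', is_succ x x' -> margin_sigma x x' <= tau x x' <= 1
    & forall x y y', is_succ y y' -> x != y -> x != y' ->
        0 <= tau x y - tau x y' <= margin_sigma y y'].

Definition sq_dist (tau : A -> A -> R) : R :=
  \sum_(xy : A * A | xy.1 != xy.2)
    (tau xy.1 xy.2 - turnover xy.1 xy.2) ^+ 2.

Definition is_turnover_sigma (tau : A -> A -> R) : Prop :=
  feasible tau /\ forall tau', feasible tau' -> sq_dist tau <= sq_dist tau'.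

Variable tau : A -> A -> R.

Definition gamma_succ (p p' : A) : set R :=
  `[(tau p p' - margin_sigma p p') / 2, (tau p p' + margin_sigma p p') / 2].

Definition gamma (x y : A) : set R :=
  [set r | exists p p',
     [/\ is_succ p p', weak x p, xi p y & gamma_succ p p' r]].

(* For xi x y, gamma x y is a nonempty finite union of compact intervals, so
   sup and inf are its maximum and minimum. *)
Definition projected (x y : A) : R :=
  if xi x y then sup (gamma x y) else inf (gamma y x).

Definition rank_like_rate (x : A) : R :=
  #|A|%:R - \sum_(y : A | y != x) projected x y.

End ProjectedScores.

(* Main.v *)
(* Projected scores lie in [0, 1], so the rate of x is 1 iff every projected
   score of x against another option is 1.  If y precedes x, then the score of x
   against y is at most the lower endpoint of an interval centred at
   tau / 2 <= 1/2; hence x must come first, and its successor x' must satisfy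
   tau = margin_sigma = 1.  As x comes first, margin_sigma x x' is the minimum of
   the margins margin_nu x q over q != x, so all of them equal 1.  This means that
   some path of links of score 1, that is, of unanimous strict preferences, leads
   from x to q, and the transitivity of the ballots makes x unanimously preferred
   to q.  Conversely, unanimity gives scores v x q = 1 and v z x = 0, so every
   path into x contains a link of score 0 and all the margins of x are 1. *)

Require Import Defs.
From mathcomp Require Import all_boot all_order all_algebra.
From mathcomp Require Import all_classical all_reals.
From mathcomp Require Import lra.

Set Implicit Arguments.
Unset Strict Implicit.
Unset Printing Implicit Defensive.

Import Order.TTheory GRing.Theory Num.Theory.
Local Open Scope ring_scope.

(** * Finite sets and strict orders *)

(** An element of [P] with the fewest [r]-predecessors works: a predecessor in [P] would have
    strictly fewer. *)
Lemma ex_minimal (T : finType) (r : rel T) (P : pred T) (a : T) :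
  irreflexive r -> transitive r -> P a ->
  exists2 m, P m & forall z, P z -> ~~ r z m.
Proof.
move=> irr tr Pa.
case: (arg_minnP (fun z => #|[pred w | r w z]|) Pa) => m Pm minm.
exists m => // z Pz; apply/negP => rzm.
have := minm z Pz; rewrite leqNgt => /negP; apply.
apply: proper_card; apply/properP; split.
  by apply/fintype.subsetP => w; rewrite !inE => /tr; apply.
by exists z; rewrite !inE ?irr.
Qed.

Lemma ex_neq (T : finType) (x : T) : (1 < #|T|)%N -> exists y, y != x.
Proof.
move=> /card_gt1P[a [b [_ _ ab]]].
by case: (eqVneq b x) ab => [<-|bx _]; [exists a | exists b].
Qed.

(** * Ballots and unanimous strict preference *)

Section Ballots.
Variables (R : realType) (A : finType).
Implicit Types (b : ballot A) (x y z : A).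

Lemma ballot_matrix_ge0 b x y : 0 <= ballot_matrix R b x y.
Proof. by rewrite /ballot_matrix; do 4?case: ifP => _ //; lra. Qed.

Lemma ballot_matrix_le1 b x y : ballot_matrix R b x y <= 1.
Proof. by rewrite /ballot_matrix; do 4?case: ifP => _ //; lra. Qed.

Lemma ballot_matrix_eq1P b x y :
  ballot_matrix R b x y = 1 <->
  x \in listed b /\ (y \in listed b -> strictly_above b x y).
Proof.
rewrite /ballot_matrix; case: (x \in listed b); last first.
  by split=> [h|[]//]; lra.
case: (y \in listed b); last by split.
case: (strictly_above b x y); first by split.
by case: (tied b x y); split=> [h|[_ /(_ isT)]//]; lra.
Qed.

(** The score 1 of [y] against [z] forces [y] to be listed, as transitivity of the ballot
    requires. *)
Lemma ballot_matrix_eq1_trans b x y z :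
  ballot_matrix R b x y = 1 -> ballot_matrix R b y z = 1 ->
  ballot_matrix R b x z = 1.
Proof.
move=> /ballot_matrix_eq1P[xL xy] /ballot_matrix_eq1P[yL yz].
apply/ballot_matrix_eq1P; split=> // zL.
have /andP[Wxy nWyx] := xy yL; have /andP[Wyz nWzy] := yz zL.
apply/andP; split; first exact: weakly_above_trans Wxy Wyz.
by apply: contra nWyx => Wzx; apply: (weakly_above_trans zL yL xL).
Qed.

Lemma ballot_matrix_eq1_eq0 b x y :
  ballot_matrix R b x y = 1 -> ballot_matrix R b y x = 0.
Proof.
move=> /ballot_matrix_eq1P[xL xy]; rewrite /ballot_matrix xL.
case: ifP => // /xy /andP[Wxy nWyx].
by rewrite /strictly_above /tied (negbTE nWyx).
Qed.

(** A second option is what makes the right side imply that [x] is listed. *)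
Lemma puts_firstP b x : (2 <= #|A|)%N ->
  puts_first b x <-> forall y, y != x -> ballot_matrix R b x y = 1.
Proof.
move=> hA; split=> [[xL xtop] y yx | top].
  by apply/ballot_matrix_eq1P; split=> //; apply: xtop.
have [y yx] := ex_neq x hA; have /ballot_matrix_eq1P[xL _] := top y yx.
by split=> // z zx; have /ballot_matrix_eq1P[] := top z zx.
Qed.

Variables (K : finType) (alpha : K -> R) (b : K -> ballot A).
Hypotheses (alpha_gt0 : forall k, 0 < alpha k)
  (alpha1 : \sum_(k : K) alpha k = 1).

Lemma collective_ge0 x y : 0 <= collective alpha b x y.
Proof.
by apply: sumr_ge0 => k _; rewrite mulr_ge0 ?ballot_matrix_ge0 // ltW.
Qed.

Lemma collective_le1 x y : collective alpha b x y <= 1.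
Proof.
rewrite -alpha1; apply: ler_sum => k _.
by rewrite ler_piMr ?ballot_matrix_le1 // ltW.
Qed.

(** The weighted deficits [alpha k * (1 - _)] are nonnegative and sum to 0; as the weights are
    positive, every deficit vanishes. *)
Lemma collective_eq1P x y :
  collective alpha b x y = 1 <-> forall k, ballot_matrix R (b k) x y = 1.
Proof.
split=> [sum1 k | all1]; last first.
  by rewrite -alpha1; apply: eq_bigr => k _; rewrite all1 mulr1.
have /psumr_eq0P/(_ k isT)/eqP :
    \sum_(k : K) alpha k * (1 - ballot_matrix R (b k) x y) = 0.
  under eq_bigr do rewrite mulrBr mulr1.
  by rewrite sumrB alpha1 -sum1 subrr.
rewrite mulf_eq0 gt_eqF //= subr_eq0 eq_sym => H; apply/eqP/H => j _.
by rewrite mulr_ge0 ?subr_ge0 ?ballot_matrix_le1 // ltW.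
Qed.

Lemma collective_eq1_eq0 x y :
  collective alpha b x y = 1 -> collective alpha b y x = 0.
Proof.
move=> /collective_eq1P all1; apply: big1 => k _.
by rewrite (ballot_matrix_eq1_eq0 (all1 k)) mulr0.
Qed.

(** Links of score 1 are unanimous, so transitivity composes them within each ballot. *)
Lemma collective_eq1_path x p :
  p != [::] ->
  {in pairmap pair x p, forall e, collective alpha b e.1 e.2 = 1} ->
  collective alpha b x (last x p) = 1.
Proof.
elim: p x => //= y [|z p] IH x _ all1 /=; first exact: (all1 (x, y) (mem_head _ _)).
have /collective_eq1P xy := all1 (x, y) (mem_head _ _).
have /collective_eq1P yl : collective alpha b y (last y (z :: p)) = 1.
  by apply: IH => // e ep; apply: all1; rewrite inE ep orbT.
by apply/collective_eq1P => k; apply: ballot_matrix_eq1_trans (xy k) (yl k).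
Qed.

End Ballots.

(** * Indirect scores and margins equal to 1 *)

Section Indirect.
Variables (R : realType) (A : finType) (v : A -> A -> R).
Hypotheses (v_ge0 : forall x y, 0 <= v x y) (v_le1 : forall x y, v x y <= 1).

Lemma path_score_le x p e :
  e \in pairmap pair x p -> path_score v x p <= v e.1 e.2.
Proof. by move=> ep; apply: bigmin_inf_seq ep _ _. Qed.

Lemma path_score_le1 x p : path_score v x p <= 1.
Proof. exact: le_trans (bigmin_le_id _ _ _ _) (v_le1 _ _). Qed.

Lemma path_score_has_ubound x y :
  has_ubound [set path_score v x p | p in [set p | is_path x y p]]%classic.
Proof. by exists 1 => _ [p _ <-]; apply: path_score_le1. Qed.

Lemma path_scores_nonempty x y : x != y ->
  ([set path_score v x p | p in [set p | is_path x y p]] !=set0)%classic.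
Proof.
by move=> xy; exists (path_score v x [:: y]), [:: y] => //; split=> //=; rewrite xy.
Qed.

Lemma direct_le_indirect x y : x != y -> v x y <= indirect v x y.
Proof.
move=> xy; apply: ub_le_sup; first exact: path_score_has_ubound.
exists [:: y]; first by split=> //=; rewrite xy.
by rewrite /path_score /= big_cons big_nil minxx.
Qed.

Lemma indirect_le1 x y : x != y -> indirect v x y <= 1.
Proof.
move=> xy; apply: ge_sup (path_scores_nonempty xy) _ => _ [p _ <-].
exact: path_score_le1.
Qed.

(** The last link of every path into [y] has score 0, which caps the score of the path. *)
Lemma indirect_eq0 x y : x != y ->
  (forall z, z != y -> v z y = 0) -> indirect v x y = 0.
Proof.
move=> xy last0; apply/eqP; rewrite eq_le; apply/andP; split; last first.
  exact: le_trans (v_ge0 x y) (direct_le_indirect xy).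
apply: ge_sup (path_scores_nonempty xy) _ => _ [p [pn0 xp plast] <-].
case: (lastP p) pn0 xp plast => // q w _; rewrite last_rcons => + wy.
rewrite {}wy rcons_path => /andP[_ qy].
rewrite -(last0 _ qy); apply: (path_score_le (e := (last x q, y))).
by rewrite -cats1 pairmap_cat mem_cat mem_head orbT.
Qed.

(* The scores below 1 are bounded away from 1, hence the supremum 1 is attained. *)
Lemma indirect_eq1_path x y : x != y -> indirect v x y = 1 ->
  exists2 p, is_path x y p & {in pairmap pair x p, forall e, v e.1 e.2 = 1}.
Proof.
move=> xy ind1.
pose c := \big[Num.max/0]_(e : A * A | v e.1 e.2 < 1) v e.1 e.2.
have c_lt : c < indirect v x y by rewrite ind1 bigmax_lt.
have [_ [p xp <-] cp] := sup_gt (path_scores_nonempty xy) c_lt.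
exists p => // e ep; apply/eqP; rewrite eq_le v_le1 leNgt.
apply/negP => e_lt1; have := lt_le_trans cp (path_score_le ep).
by rewrite ltNge le_bigmax_cond.
Qed.

(** The margin is a difference of two numbers in [0, 1], so it reaches 1 only if the first of them
    is 1. *)
Lemma margin_nu_ge1 x y : x != y -> 1 <= margin_nu v x y ->
  indirect v x y = 1.
Proof.
move=> xy; have := @direct_le_indirect y x; rewrite eq_sym => /(_ xy).
by rewrite /margin_nu; have := indirect_le1 xy; have := v_ge0 y x; lra.
Qed.

Lemma margin_nu_eq1 x y : x != y ->
  v x y = 1 -> (forall z, z != x -> v z x = 0) -> margin_nu v x y = 1.
Proof.
move=> xy vxy last0; rewrite /margin_nu (@indirect_eq0 y x) // 1?eq_sym // subr0.
by apply/eqP; rewrite eq_le indirect_le1 // -vxy direct_le_indirect.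
Qed.

End Indirect.

(** * Projected scores and the rank-like rate *)

Section Projected.
Variables (R : realType) (A : finType) (v : A -> A -> R) (xi : rel A).
Hypothesis xi_adm : admissible v xi.
Variable tau : A -> A -> R.
Hypothesis tau_feas : feasible v xi tau.

Lemma ex_succ x y : xi x y -> exists x', is_succ xi x x'.
Proof.
have [irr tr _ _ _] := xi_adm => xy.
have [x' xx' minx'] := ex_minimal irr tr xy.
exists x'; rewrite /is_succ xx'; apply/forallP => z.
by apply/negP => /andP[/minx'/negP].
Qed.

Lemma ex_pred x y : xi x y ->
  exists q, [/\ is_succ xi q y, weak xi x q & xi q y].
Proof.
have [irr tr tot _ _] := xi_adm => xy.
(* A minimal element for the reversed order is the [xi]-last option before [y]. *)
have tr' : transitive (fun a b => xi b a) by move=> a b c ba ca; apply: tr ca ba.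
have [q qy maxq] := ex_minimal (P := xi^~ y) (irr : irreflexive (fun a b => xi b a)) tr' xy.
exists q; split=> //.
  rewrite /is_succ qy; apply/forallP => z.
  by apply/negP => /andP[qz /maxq/negP].
rewrite /weak; case: eqVneq => //= /tot/orP[//|qx].
by have := maxq x xy; rewrite qx.
Qed.

(** Every pair in the range of the minimum is itself in [xi], and admissibility makes margins along
    [xi] nonnegative. *)
Lemma margin_sigma_ge0 x y : xi x y -> 0 <= margin_sigma v xi x y.
Proof.
have [_ tr _ _ nonneg] := xi_adm => xy.
apply: le_bigmin => [|[p q] /= /andP[px yq]]; first exact: nonneg.
apply: nonneg; case/predU1P: px => [->|px]; last apply: (tr _ _ _ px).
  by case/predU1P: yq => [<-//|]; apply: tr.
by case/predU1P: yq => [<-//|]; apply: tr.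
Qed.

Lemma succ_bounds x x' : is_succ xi x x' ->
  [/\ 0 <= margin_sigma v xi x x', margin_sigma v xi x x' <= tau x x'
    & tau x x' <= 1].
Proof.
have [_ bounds _] := tau_feas => s.
have /andP[mt t1] := bounds _ _ s; have /andP[xx' _] := s.
by split=> //; apply: margin_sigma_ge0.
Qed.

Lemma gamma_bounds x y r : gamma v xi tau x y r -> 0 <= r <= 1.
Proof.
move=> [p [p' [s _ _]]]; rewrite /gamma_succ /= in_itv /= => /andP[lo up].
by have [] := succ_bounds s; lra.
Qed.

Lemma gamma_has_ubound x y : has_ubound (gamma v xi tau x y).
Proof. by exists 1 => r /gamma_bounds/andP[]. Qed.

Lemma gamma_has_lbound x y : has_lbound (gamma v xi tau x y).
Proof. by exists 0 => r /gamma_bounds/andP[]. Qed.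

Lemma gamma_endpoints p p' x y : is_succ xi p p' -> weak xi x p -> xi p y ->
  gamma v xi tau x y ((tau p p' - margin_sigma v xi p p') / 2) /\
  gamma v xi tau x y ((tau p p' + margin_sigma v xi p p') / 2).
Proof.
move=> s xp py; have [m0 mt t1] := succ_bounds s.
by split; exists p, p'; split=> //; rewrite /gamma_succ /= in_itv /=; lra.
Qed.

Lemma projected_backward_lt1 x y : xi y x -> projected v xi tau x y < 1.
Proof.
have [irr tr _ _ _] := xi_adm => yx.
have /negbTE nxy : ~~ xi x y.
  by apply/negP => /(tr _ _ _ yx); rewrite irr.
have [q [s yq qx]] := ex_pred yx.
have [lo _] := gamma_endpoints s yq qx.
rewrite /projected nxy; apply: le_lt_trans (ge_inf (gamma_has_lbound y x) lo) _.
(* The lower endpoint is at most 1/2, because [tau q x <= 1] and the margin is nonnegative. *)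
by have [] := succ_bounds s; lra.
Qed.

Lemma projected_le1 x y : x != y -> projected v xi tau x y <= 1.
Proof.
have [_ _ tot _ _] := xi_adm => /tot/orP[xy|/projected_backward_lt1/ltW//].
rewrite /projected xy; apply: ge_sup => [|r /gamma_bounds/andP[]//].
have [q [s xq qy]] := ex_pred xy.
by have [lo _] := gamma_endpoints s xq qy; eexists; exact: lo.
Qed.

(** The rate exceeds 1 by the sum of the nonnegative deficits [1 - projected] over the other
    options. *)
Lemma rank_like_rate_eq1P x :
  rank_like_rate v xi tau x = 1 <->
  forall y, y != x -> projected v xi tau x y = 1.
Proof.
have cardE : #|A|%:R - \sum_(y | y != x) 1 = 1 :> R.
  by rewrite -sum1_card natr_sum (bigD1 x) //= addrK.
split=> [r1 | all1]; last first.
  by rewrite /rank_like_rate (eq_bigr _ all1).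
have /psumr_eq0P sum0 : \sum_(y | y != x) (1 - projected v xi tau x y) = 0.
  by rewrite sumrB; move: r1 cardE; rewrite /rank_like_rate; lra.
move=> y yx; apply/eqP; rewrite eq_sym -subr_eq0; apply/eqP/sum0 => // z zx.
by rewrite subr_ge0 projected_le1 // eq_sym.
Qed.

(** Nothing lies strictly between [x] and [x'], so the union [gamma] consists of a single
    interval. *)
Lemma projected_succ x x' : is_succ xi x x' ->
  projected v xi tau x x' = (tau x x' + margin_sigma v xi x x') / 2.
Proof.
have [irr tr tot _ _] := xi_adm => s; have /andP[xx' /forallP between] := s.
have xw : weak xi x x by rewrite /weak eqxx.
have [_ up] := gamma_endpoints s xw xx'.
rewrite /projected xx'; apply/eqP; rewrite eq_le.
rewrite (ub_le_sup (gamma_has_ubound x x') up) andbT.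
apply: ge_sup; first by eexists; exact: up.
move=> r [p [p' [s' xp px']]].
have {xp px'} px : p = x.
  by case/predU1P: xp => // xp; have := between p; rewrite xp px'.
have {s'} p'E : p' = x'.
  have /andP[pp' /forallP between'] := s'; rewrite {}px in pp' between'.
  case: (eqVneq p' x') => // /tot/orP[p'x'|x'p'].
    by have := between p'; rewrite pp' p'x'.
  by have := between' x'; rewrite xx' x'p'.
by rewrite px p'E /gamma_succ /= in_itv /= => /andP[].
Qed.

Lemma projected_eq1P x : (2 <= #|A|)%N ->
  (forall y, y != x -> projected v xi tau x y = 1) <->
  (forall y, y != x -> 1 <= margin_nu v x y).
Proof.
have [irr tr tot strict _] := xi_adm => hA.
have [a ax] := ex_neq x hA.
split=> [all1 | margin1].
  have first y : y != x -> xi x y.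
    move=> yx; have /orP[xiyx|//] := tot _ _ yx.
    by have := projected_backward_lt1 xiyx; rewrite all1 // ltxx.
  have [x' s] := ex_succ (first a ax).
  have /andP[xx' /forallP between] := s.
  have x'x : x' != x by apply: contraTneq xx' => ->; rewrite irr.
  (* The upper endpoint is 1 while margin <= [tau] <= 1, so both equal 1. *)
  have m1 : 1 <= margin_sigma v xi x x'.
    have := all1 x' x'x; rewrite projected_succ //.
    by have [] := succ_bounds s; lra.
  move=> y yx; apply: le_trans m1 _.
  (* The pair [(x, y)] enters the minimum because [y] is [x'] or comes after it. *)
  apply: (bigmin_le_cond (j := (x, y)) _ (fun pq => margin_nu v pq.1 pq.2)).
  rewrite /weak eqxx /=.
  case: eqVneq => //= /tot/orP[//|yx'].
  by have := between y; rewrite first // yx'.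
have first y : y != x -> xi x y.
  move=> yx; apply: strict; first by rewrite eq_sym.
  exact: lt_le_trans ltr01 (margin1 y yx).
have [x' s] := ex_succ (first a ax).
have /andP[xx' _] := s.
have x'x : x' != x by apply: contraTneq xx' => ->; rewrite irr.
have m1 : 1 <= margin_sigma v xi x x'.
  apply: le_bigmin => [|[p q] /= /andP[px x'q]]; first exact: margin1.
  have xq : xi x q by case/predU1P: x'q => [<-//|]; apply: tr.
  have qx : q != x by apply: contraTneq xq => ->; rewrite irr.
  case/predU1P: px => [->|px]; first exact: margin1.
  (* As [x] comes first, no [p] can precede it; only the pairs [(x, q)] remain. *)
  have pNx : p != x by apply: contraTneq px => ->; rewrite irr.
  by have := tr _ _ _ px (first p pNx); rewrite irr.
move=> y yx; apply/eqP; rewrite eq_le projected_le1 1?eq_sym //=.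
have xw : weak xi x x by rewrite /weak eqxx.
(* The interval of [x] and [x'] is part of [gamma x y] for every later [y], and its upper endpoint
   is at least 1. *)
have [_ up] := gamma_endpoints s xw (first y yx).
rewrite /projected first //; apply: le_trans (ub_le_sup (gamma_has_ubound x y) up).
by have [] := succ_bounds s; lra.
Qed.

End Projected.

Theorem corollary14p7 (R : realType) (A : finType) (hA : (2 <= #|A|)%N)
    (K : finType) (alpha : K -> R) (b : K -> ballot A)
    (halpha : forall k, 0 < alpha k) (halpha1 : \sum_(k : K) alpha k = 1)
    (xi : rel A) (hxi : admissible (collective alpha b) xi)
    (tau : A -> A -> R)
    (htau : is_turnover_sigma (collective alpha b) xi tau) (x : A) :
  rank_like_rate (collective alpha b) xi tau x = 1 <->
  (forall k : K, puts_first (b k) x).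
Proof.
have [feas _] := htau.
have v0 := collective_ge0 b halpha.
have v1 := collective_le1 b halpha halpha1.
rewrite rank_like_rate_eq1P // projected_eq1P //.
split=> [margin1 k | top y yx].
  (* For a fixed [y], the claim over all voters [k] amounts to a collective score of 1. *)
  apply/(puts_firstP R) => // y yx; move: k; rewrite eq_sym in yx.
  apply/(collective_eq1P b halpha halpha1).
  have ind1 := margin_nu_ge1 v0 v1 yx (margin1 y ltac:(by rewrite eq_sym)).
  have [p [pn0 _ <-] p1] := indirect_eq1_path v1 yx ind1.
  exact: collective_eq1_path.
have vx z : z != x -> collective alpha b x z = 1.
  move=> zx; apply/collective_eq1P => // k.
  by have /(puts_firstP R) -> := top k.
rewrite margin_nu_eq1 ?vx // 1?eq_sym // => z zx.
by apply: collective_eq1_eq0; rewrite ?vx.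
Qed.
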